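(* For the problem Triangle Deletion: (I) Triangle Deletion parameterized by solution size $k$ is $(\mathrm{VA}, n\log n)$-hard, even when restricted to input graphs $G$ with average degree $\Delta_{av}(G)=O(1)$; (II) Triangle Deletion parameterized by solution size $k$ is $(\mathrm{VA}, n/p, p)$-hard for every $p\in\mathbb{N}$, even when restricted to input graphs $G$ with maximum degree $\Delta(G)=O(1)$; (III) Triangle Deletion parameterized by vertex cover size $K$ is $(\mathrm{VA}, n/p, p)$-hard for every $p\in\mathbb{N}$, even when restricted to input graphs $G$ with average degree $\Delta_{av}(G)=O(1)$.
   Context: All graphs are finite, simple and undirected; $n$ is the number of vertices of the input graph $G$, and the vertex set is known in advance. $\Delta(G)$ and $\Delta_{av}(G)$ denote the maximum and the average degree of $G$; ''restricted to graphs with $\Delta(G)=O(1)$'' (resp. $\Delta_{av}(G)=O(1)$) means that the hardness holds already for inputs in which this quantity is at most some absolute constant. Triangle Deletion: the input is a graph $G$ (presented as a stream) and a non-negative integer $k$; the question is whether there is a set $X\subset V(G)$ of size at most $k$ such that $G\setminus X$ (the subgraph induced by $V(G)\setminus X$) contains no triangle. When the problem is parameterized by vertex cover size $K$, the algorithm is additionally given an integer $K$ with the promise that the minimum vertex cover of $G$ has size at most $K$, and $k\le K$. VA (vertex arrival) model: the vertices are exposed one after another in an arbitrary order; when a vertex $v$ is exposed, all edges between $v$ and its already exposed neighbors are revealed one by one in an arbitrary order. A $p$-pass streaming algorithm may read the stream $p$ times in the same order. It solves a problem in a streaming model if it is a (possibly randomized) algorithm which, on every input instance presented in that model, gives the correct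 output with probability at least $2/3$. For a streaming model $\mathcal{M}$ and a function $f$ of $n$ and the parameter, a problem is $(\mathcal{M},f,p)$-hard if no $p$-pass streaming algorithm using $o(f)$ bits of space solves it in model $\mathcal{M}$; $(\mathcal{M},f)$-hard means $(\mathcal{M},f,1)$-hard. *)

(* Defs.v *)
From HB Require Import structures.
From mathcomp Require Import all_boot all_order all_algebra.
From mathcomp Require Import all_classical all_reals all_analysis.
Import Order.TTheory GRing.Theory Num.Theory.
Import numFieldNormedType.Exports.

Set Implicit Arguments.
Unset Strict Implicit.
Unset Printing Implicit Defensive.

Local Open Scope ring_scope.

Record sgraph (V : finType) := SGraph {
  adj :> rel V;
  adj_sym : symmetric adj;
  adj_irrefl : irreflexive adj
}.

Section Graphs.
Context {V : finType}.
Implicit Types (G : sgraph V) (X A S : {set V}).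

Definition degree G (v : V) : nat := #|[set u | G v u]|.

Definition max_degree G : nat := (\max_(v : V) degree G v)%N.

Definition avg_degree (R : realType) G : R :=
  (\sum_(v : V) degree G v)%N%:R / #|V|%:R.

Definition induced_adj G A : rel {v : V | v \in A} :=
  fun u v => G (val u) (val v).

Lemma induced_adj_sym G A : symmetric (induced_adj G (A := A)).
Proof. by move=> u v; rewrite /induced_adj adj_sym. Qed.

Lemma induced_adj_irrefl G A : irreflexive (induced_adj G (A := A)).
Proof. by move=> u; rewrite /induced_adj adj_irrefl. Qed.

Definition induced G A : sgraph {v : V | v \in A} :=
  SGraph (@induced_adj_sym G A) (@induced_adj_irrefl G A).

Definition delete G X : sgraph {v : V | v \in ~: X} := induced G (~: X).

Definition vertex_cover G S : bool :=
  [forall u, forall v, G u v ==> ((u \in S) || (v \in S))].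

(* The default [setT] of the arg min is always a vertex cover. *)
Definition vc_number G : nat :=
  #|[arg min_(S < [set: V] | vertex_cover G S) #|S|]|.

End Graphs.

Definition triangle_free (V : finType) (G : sgraph V) : bool :=
  ~~ [exists x, exists y, exists z, [&& G x y, G y z & G x z]].

Definition triangle_deletion (n : nat) (G : sgraph 'I_n) (k : nat) : bool :=
  [exists X : {set 'I_n}, (#|X| <= k)%N && triangle_free (delete G X)].

(* [Arrive v]: the vertex v is exposed; [Edge v u]: the edge between v and u
   is revealed. *)
Inductive token (n : nat) := Arrive of 'I_n | Edge of 'I_n & 'I_n.

(* A streaming model says which token sequences present a given graph. *)
Definition model := forall n : nat, sgraph 'I_n -> seq (token n) -> Prop.

(* [va_prefix G s t]: t is a vertex-arrival stream exposing exactly the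
   vertices of s, in that order. *)
Inductive va_prefix (n : nat) (G : sgraph 'I_n) :
    seq 'I_n -> seq (token n) -> Prop :=
| va_nil : va_prefix G [::] [::]
| va_expose (s : seq 'I_n) (t : seq (token n)) (v : 'I_n) (l : seq 'I_n) :
    va_prefix G s t -> v \notin s ->
    uniq l -> (forall u, (u \in l) = (u \in s) && G v u) ->
    va_prefix G (rcons s v) (t ++ Arrive v :: [seq Edge v u | u <- l]).

Definition VA : model := fun n G t =>
  exists2 s : seq 'I_n, (forall v, v \in s) & va_prefix G s t.

(* A randomized algorithm with b bits of memory, as a distribution over
   deterministic ones: all coins are drawn beforehand as a seed.  The
   transition may also depend on the pass number and on the position in the
   stream, so that it can use fresh coins at each step.  Neither the seed nor
   this clock is charged to the memory, and the algorithm may be non-uniform;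
   all this only enlarges the class of algorithms that hardness rules out.
   A finite seed space is enough because for given b, number of passes and
   maximal stream length there are only finitely many deterministic
   behaviours. *)
Record algorithm (R : realType) (T : Type) (b : nat) := Algorithm {
  seed : finType;
  seed_prob : seed -> R;
  seed_prob_ge0 : forall w, 0 <= seed_prob w;
  seed_prob_sum1 : \sum_w seed_prob w = 1;
  init : seed -> b.-tuple bool;
  step : seed -> nat -> nat -> b.-tuple bool -> T -> b.-tuple bool;
  output : seed -> b.-tuple bool -> bool
}.

Section Run.
Context {R : realType} {T : Type} {b : nat}.
Variable A : algorithm R T b.

Definition run_pass (w : seed A) (i : nat) (q : b.-tuple bool) (t : seq T) :=
  foldl (fun q jx => step w i jx.1 q jx.2) q (zip (iota 0 (size t)) t).

Definition run (p : nat) (w : seed A) (t : seq T) : bool :=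
  output w (foldl (fun q i => run_pass w i q t) (init w) (iota 0 p)).

Definition prob_output (p : nat) (t : seq T) (answer : bool) : R :=
  \sum_(w | run p w t == answer) seed_prob w.

End Run.

(* An input is a graph G with an integer k, plus the value kappa of the
   parameter; [inputs] is the promise relating them. *)
Record problem := Problem {
  inputs : forall n : nat, sgraph 'I_n -> nat -> nat -> Prop;
  answer : forall n : nat, sgraph 'I_n -> nat -> bool
}.

Definition TD_solution_size : problem := {|
  inputs := fun n G k kappa => kappa = k;
  answer := triangle_deletion
|}.

Definition TD_vertex_cover : problem := {|
  inputs := fun n G k kappa => (vc_number G <= kappa)%N /\ (k <= kappa)%N;
  answer := triangle_deletion
|}.

Definition restricted_to (P : problem)
    (C : forall n : nat, sgraph 'I_n -> Prop) : problem := {|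
  inputs := fun n G k kappa => inputs P G k kappa /\ C n G;
  answer := answer P
|}.

(* The algorithm knows n, k and kappa before the stream starts. *)
Definition solves (R : realType) (M : model) (P : problem) (p : nat)
    (space : nat -> nat -> nat)
    (A : forall n k kappa : nat, algorithm R (token n) (space n kappa)) : Prop :=
  forall (n : nat) (G : sgraph 'I_n) (k kappa : nat) (t : seq (token n)),
    inputs P G k kappa -> M n G t ->
    2 / 3 <= prob_output (A n k kappa) p t (answer P G k).

Local Open Scope classical_set_scope.

(* The o is taken as n tends to infinity, for each fixed value of the
   parameter, with no uniformity in the parameter: an algorithm using
   g(kappa) * o(f) bits, for arbitrary g, is ruled out too. *)
Definition little_o (R : realType) (space : nat -> nat -> nat)
    (f : nat -> nat -> R) : Prop :=
  forall kappa : nat,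
    (fun n : nat => (space n kappa)%:R : R^o) =o_\oo
    (fun n : nat => f n kappa : R^o).

Definition hard (R : realType) (M : model) (P : problem)
    (f : nat -> nat -> R) (p : nat) : Prop :=
  forall space : nat -> nat -> nat, little_o space f ->
  ~ exists A : forall n k kappa : nat, algorithm R (token n) (space n kappa),
      solves M P p A.

(* Main.v *)
(* All three bounds hold already for k = 0, that is, for testing whether the
   graph is triangle-free, by reductions from two-party communication.

   The common tool is the level-one inequality: if f : {0,1}^I -> [0,1] has mean
   m and d_i is its correlation with (-1)^(x_i), then
   sum_i d_i^2 <= 6 m^2 ln (1/m).  So a message (or transcript) of few bits
   leaves almost every coordinate of a uniform input almost unbiased.  This
   bounds INDEX directly.  For DISJOINTNESS, let every element belong to a
   random side and let only that side hold it, with probability 1/2; then for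
   most i the transcript is distributed nearly alike whether i is held by
   nobody, by Alice, or by Bob.  Since the probability of a transcript is a
   product of an Alice factor and a Bob factor, it is not much rarer when both
   hold i, so the protocol cannot tell intersecting from disjoint inputs.

   (I) Alice's edges encode a function from N keys to N values, i.e. N log N
   bits; Bob's vertex is joined to a key and to all values with a given bit, so
   that a triangle appears iff this bit of the value of the key is 1.
   (II), (III) Element i yields a triangle iff both players hold it.  Every
   vertex of Alice has as many edges to earlier vertices whatever her input is,
   so that the clock of the algorithm carries no information to Bob. *)
Require Import Defs.
From mathcomp Require Import all_boot all_order all_algebra.
From mathcomp Require Import all_classical all_reals all_analysis.
From mathcomp Require Import ring lra zify.
Import Order.TTheory GRing.Theory Num.Theory.

Set Implicit Arguments.
Unset Strict Implicit.
Unset Printing Implicit Defensive.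

Local Open Scope ring_scope.

(** * Averages over the cube *)

Section CubeAverage.
Context {R : realType} {I : finType}.
Local Notation cube := {ffun I -> bool}.
Implicit Types (f g : cube -> R) (x : cube) (i : I) (b : bool).

Definition avg f : R := (\sum_x f x) / 2 ^+ #|I|.

Lemma eq_avg f g : f =1 g -> avg f = avg g.
Proof. by move=> fg; rewrite /avg (eq_bigr g). Qed.

Lemma avgD f g : avg (fun x => f x + g x) = avg f + avg g.
Proof. by rewrite /avg big_split mulrDl. Qed.

Lemma avgZ a f : avg (fun x => a * f x) = a * avg f.
Proof. by rewrite /avg -mulr_sumr mulrA. Qed.

Lemma avgZr a f : avg (fun x => f x * a) = avg f * a.
Proof. by rewrite /avg -mulr_suml mulrAC. Qed.

Lemma avg_sum (J : Type) (r : seq J) (P : pred J) (F : J -> cube -> R) :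
  avg (fun x => \sum_(j <- r | P j) F j x) = \sum_(j <- r | P j) avg (F j).
Proof. by rewrite /avg exchange_big /= mulr_suml. Qed.

Lemma avg_cst a : avg (fun=> a) = a.
Proof.
rewrite /avg sumr_const card_ffun card_bool -[a *+ _]mulr_natr natrX.
by rewrite mulfK // expf_neq0 // pnatr_eq0.
Qed.

Lemma le_avg f g : (forall x, f x <= g x) -> avg f <= avg g.
Proof. by move=> fg; rewrite ler_wpM2r ?invr_ge0 ?exprn_ge0 //; apply: ler_sum. Qed.

Lemma avg_ge0 f : (forall x, 0 <= f x) -> 0 <= avg f.
Proof. by move=> f0; rewrite -(avg_cst 0); apply: le_avg. Qed.

Definition upd x i b : cube := [ffun j => if j == i then b else x j].

Lemma upd_upd x i b c : upd (upd x i b) i c = upd x i c.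
Proof. by apply/ffunP => j; rewrite !ffunE; case: eqP. Qed.

Lemma upd_id x i : upd x i (x i) = x.
Proof. by apply/ffunP => j; rewrite !ffunE; case: eqP => [->|]. Qed.

Lemma avg_upd i f :
  avg f = (avg (fun x => f (upd x i false)) + avg (fun x => f (upd x i true))) / 2.
Proof.
pose flip x := upd x i (~~ x i).
have flipK : involutive flip.
  by move=> x; rewrite /flip upd_upd !ffunE eqxx negbK upd_id.
have -> : avg f = avg (fun x => f (flip x)).
  by rewrite /avg (reindex_inj (inv_inj flipK)).
rewrite -avgD -avgZr /avg; congr (_ / _).
rewrite -[LHS]mulr1 -[X in _ * X](mulfV (x := 2)) ?pnatr_eq0 // mulrA -mulr_suml.
congr (_ / _); rewrite -[2]natr1 mulrDr !mulr1.
rewrite {1}(reindex_inj (inv_inj flipK)) -big_split /=; apply: eq_bigr => x _.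
by rewrite flipK /flip -{1}(upd_id x i); case: (x i); rewrite //= addrC.
Qed.

End CubeAverage.

(** * The level-one inequality and the entropy bound *)

Section LevelOne.
Context {R : realType} {I : finType}.
Local Notation cube := {ffun I -> bool}.

(** Averaging [expR z <= (1 - z)^-1] over [z = y] and [z = - y] gives [(1 - y ^+ 2)^-1], which is at
    most [1 + 4 / 3 * y ^+ 2] because [y ^+ 2 <= 1 / 4]. *)
Lemma cosh_le (y : R) : `|y| <= 2^-1 ->
  (expR y + expR (- y)) / 2 <= expR (4 / 3 * y ^+ 2).
Proof.
rewrite ler_norml => /andP[y1 y2].
have expV_le (z : R) : z < 1 -> expR z <= (1 - z)^-1.
  move=> z1; rewrite -[expR z]invrK lef_pV2 ?posrE ?invr_gt0 ?expR_gt0 ?subr_gt0 //.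
  by rewrite -expRN; apply: expR_ge1Dx.
have y_lt : y < 1 by lra.
have yN_lt : - y < 1 by lra.
have sq : y ^+ 2 <= 4^-1 by rewrite expr2; nra.
apply: le_trans (expR_ge1Dx _).
apply: le_trans (_ : ((1 - y)^-1 + (1 - - y)^-1) / 2 <= _).
  by rewrite ler_wpM2r ?invr_ge0 // lerD ?expV_le.
have -> : ((1 - y)^-1 + (1 - - y)^-1) / 2 = (1 - y ^+ 2)^-1.
  by field; rewrite !gt_eqF //; lra.
rewrite -[leLHS]mul1r ler_pdivrMr; last lra.
have := sqr_ge0 y; move: sq; set s := y ^+ 2 => s1 s0; nra.
Qed.

Lemma avg_expR_linear (c : I -> R) :
  avg (fun x : cube => expR (\sum_i c i * (-1) ^+ x i)) =
  \prod_i ((expR (c i) + expR (- c i)) / 2).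
Proof.
rewrite /avg (eq_bigr (fun x : cube => \prod_i expR (c i * (-1) ^+ x i))); last first.
  by move=> x _; rewrite expR_sum.
rewrite -(bigA_distr_bigA (fun i (b : bool) => expR (c i * (-1) ^+ b))) big_split /=.
rewrite prodr_const exprVn; congr (_ * _).
by apply: eq_bigr => i _; rewrite big_bool /= mulr1 mulrN1 addrC.
Qed.

(* Exponential moments: with c = d / m, compare the average of [f * exp Z],
   Z = 1/2 sum_i c_i (-1)^(x_i), with that of [exp Z] (as f <= 1); Jensen
   bounds it below. *)
Lemma level_one (f : cube -> R) (d := fun i => avg (fun x => f x * (-1) ^+ x i)) :
  (forall x, 0 <= f x <= 1) ->
  \sum_i d i ^+ 2 / avg f <= 6 * (avg f * ln (avg f)^-1).
Proof.
move=> f01; have f0 x : 0 <= f x by case/andP: (f01 x).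
(* For [m = 0] the quotients on the left are 0, since the inverse of 0 is 0. *)
set m := avg f; have [m0|m0] := eqVneq m 0.
  rewrite m0 mul0r mulr0 big1 // => i _; by rewrite invr0 mulr0.
have mp : 0 < m by rewrite lt_def m0 avg_ge0.
pose c i := d i / m; pose Q := \sum_i c i ^+ 2.
have dm i : `|d i| <= m.
  rewrite ler_norml; apply/andP; split; last first.
    apply: le_avg => x; rewrite -[leRHS]mulr1 ler_wpM2l //.
    by case: (x i); rewrite ?expr1 ?expr0 // lerN10_ler1.
  rewrite -mulN1r -avgZ; apply: le_avg => x; rewrite mulN1r -mulrN1 ler_wpM2l //.
  by case: (x i); rewrite ?expr1 ?expr0 //; lra.
have c1 i : `|c i / 2| <= 2^-1.
  have : `|c i| <= 1 by rewrite /c normf_div (gtr0_norm mp) ler_pdivrMr ?mul1r.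
  by rewrite !ler_norml => /andP[? ?]; apply/andP; split; lra.
pose Z (x : cube) := \sum_i c i / 2 * (-1) ^+ x i.
have up : avg (fun x => f x * expR (Z x)) <= expR (Q / 3).
  apply: le_trans (_ : avg (fun x => expR (Z x)) <= _).
    apply: le_avg => x; rewrite -[leRHS]mul1r ler_wpM2r ?expR_ge0 //.
    by case/andP: (f01 x).
  rewrite avg_expR_linear /Q mulr_suml expR_sum; apply: ler_prod => i _.
  rewrite divr_ge0 ?addr_ge0 ?expR_ge0 //=.
  apply: le_trans (cosh_le (c1 i)) _; rewrite ler_expR le_eqVlt; apply/orP; left.
  by apply/eqP; field.
(* The tangent to the exponential is taken at [Q / 2], the mean of [Z] under the density [f / m], so
   that the linear term averages to 0. *)
have dn : m * expR (Q / 2) <= avg (fun x => f x * expR (Z x)).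
  apply: le_trans (_ : avg (fun x => f x * (expR (Q / 2) * (1 + (Z x - Q / 2)))) <= _).
    rewrite (eq_avg (g := fun x => expR (Q / 2) * (1 - Q / 2) * f x +
       expR (Q / 2) * \sum_i (c i / 2) * (f x * (-1) ^+ x i))); last first.
      move=> x; rewrite /Z.
      have -> : \sum_i c i / 2 * (f x * (-1) ^+ x i) = f x * \sum_i c i / 2 * (-1) ^+ x i.
        by rewrite mulr_sumr; apply: eq_bigr => i _; rewrite mulrCA.
      ring.
    rewrite avgD !avgZ avg_sum -/m.
    have -> : \sum_i avg (fun x => c i / 2 * (f x * (-1) ^+ x i)) = m * (Q / 2).
      rewrite /Q mulr_suml mulr_sumr; apply: eq_bigr => i _.
      by rewrite avgZ -/(d i) /c; field.
    by rewrite le_eqVlt; apply/orP; left; apply/eqP; ring.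
  apply: le_avg => x; apply: ler_wpM2l => //.
  have -> : expR (Z x) = expR (Q / 2) * expR (Z x - Q / 2).
    by rewrite -expRD; congr expR; ring.
  by rewrite ler_wpM2l ?expR_ge0 // expR_ge1Dx.
(* The gap [Q / 2 - Q / 3 = Q / 6] between the two exponents is the source of the constant 6. *)
have key : Q / 6 <= ln m^-1.
  rewrite -ler_expR lnK ?posrE ?invr_gt0 //.
  rewrite -[leRHS]mul1r ler_pdivlMr // mulrC.
  rewrite -(ler_pM2r (expR_gt0 (Q / 3))) mul1r -mulrA -expRD.
  have -> : Q / 6 + Q / 3 = Q / 2 by field.
  exact: le_trans dn up.
have -> : \sum_i d i ^+ 2 / m = m * Q.
  by rewrite /Q mulr_sumr; apply: eq_bigr => i _; rewrite /c; field.
by rewrite mulrCA ler_pM2l //; lra.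
Qed.

End LevelOne.

(** Gibbs' inequality against the uniform distribution: [ln z <= z - 1] at [z = 1 / (#|T| * P t)]
    bounds each difference by [1 / #|T| - P t], and these sum to 0. *)
Lemma entropy_le (R : realType) (T : finType) (P : T -> R) :
  (forall t, 0 <= P t) -> \sum_t P t = 1 ->
  \sum_t P t * ln (P t)^-1 <= ln #|T|%:R.
Proof.
move=> P0 P1.
have Tp : (0 < #|T|)%N.
  rewrite lt0n; apply/eqP => T0; move: P1; rewrite big1 => [/eqP|t _].
    by rewrite eq_sym oner_eq0.
  by move: (fintype0 t T0).
have Tp' : 0 < #|T|%:R :> R by rewrite ltr0n.
have -> : ln #|T|%:R = \sum_t P t * ln #|T|%:R :> R by rewrite -mulr_suml P1 mul1r.
rewrite -subr_le0 -sumrB.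
apply: le_trans (_ : \sum_t (#|T|%:R^-1 - P t) <= _).
  apply: ler_sum => t _; have [->|Pt] := eqVneq (P t) 0.
    by rewrite !mul0r !subr0 invr_ge0 ler0n.
  have Pp : 0 < P t by rewrite lt_def Pt P0.
  rewrite -mulrBr -lnV ?posrE ?invr_gt0 // -?lnM ?posrE ?invr_gt0 ?mulr_gt0 ?invr_gt0 //.
  set z := (P t)^-1 / _.
  have zp : 0 < z by rewrite /z mulr_gt0 ?invr_gt0.
  have zE : P t * z = #|T|%:R^-1 by rewrite /z mulrA divff // mul1r.
  rewrite -zE -[X in _ <= _ - X]mulr1 -mulrBr ler_wpM2l ?P0 //.
  have -> : z = 1 + (z - 1) by ring.
  by apply: le_trans (le_ln1Dx _) _; lra.
by rewrite sumrB P1 sumr_const -[_ *+ #|_|]mulr_natr mulVf ?gt_eqF // subrr.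
Qed.

(** * INDEX and DISJOINTNESS *)

Section OneWay.
Context {R : realType} {I T : finType}.
Local Notation cube := {ffun I -> bool}.

(** Here [a t x] is the probability of message [t] on input [x], and [g t i] the guess for bit [i].
    Guessing beats 1/2 by half the signed correlations, whose squares are controlled by the
    level-one inequality and then by entropy. The rate 7/12 stays below 2/3. *)
Lemma one_way_success (a : T -> cube -> R) (g : T -> I -> bool) :
  (forall t x, 0 <= a t x <= 1) -> (forall x, \sum_t a t x = 1) ->
  \sum_i avg (fun x => \sum_t a t x * (g t i == x i)%:R)
    <= 7 / 12 * #|I|%:R + 9 / 2 * ln #|T|%:R.
Proof.
move=> a01 a1.
have a0 t x : 0 <= a t x by case/andP: (a01 t x).
pose m t := avg (a t); pose d t i := avg (fun x => a t x * (-1) ^+ x i).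
have m1 : \sum_t m t = 1.
  by rewrite /m -avg_sum (eq_avg (g := fun=> 1)) ?avg_cst // => x; rewrite a1.
have m0 t : 0 <= m t by apply: avg_ge0.
have succ i : avg (fun x => \sum_t a t x * (g t i == x i)%:R) =
    2^-1 + 2^-1 * \sum_t (-1) ^+ g t i * d t i.
  rewrite /d (eq_avg (g := fun x => 2^-1 * 1 +
      2^-1 * \sum_t (-1) ^+ g t i * (a t x * (-1) ^+ x i))); last first.
    move=> x; have -> : 2^-1 * 1 = 2^-1 * \sum_t a t x :> R by rewrite a1.
    rewrite -mulrDr -big_split mulr_sumr /=.
    apply: eq_bigr => t _; case: (g t i); case: (x i) => /=;
    by rewrite ?expr0 ?expr1; lra.
  rewrite avgD avg_cst mulr1 avgZ avg_sum; congr (_ + _ * _).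
  by apply: eq_bigr => t _; rewrite avgZ.
(* AM-GM from [(m t - 3 * s) ^+ 2 >= 0]. The weight 1/6 on [m t] turns 1/2 into 7/12. *)
have dle t i : (-1) ^+ g t i * d t i <= m t / 6 + 3 / 2 * (d t i ^+ 2 / m t).
  have dm : `|d t i| <= m t.
    rewrite ler_norml; apply/andP; split; last first.
      by apply: le_avg => x; have := a0 t x; case: (x i); rewrite ?expr1 ?expr0; lra.
    rewrite -mulN1r -avgZ; apply: le_avg => x.
    by have := a0 t x; case: (x i); rewrite ?expr1 ?expr0; lra.
  have [mt0|mt0] := eqVneq (m t) 0.
    move: dm; rewrite mt0 normr_le0 => /eqP ->.
    by rewrite mulr0 expr0n /= !mul0r mulr0 addr0.
  have mp : 0 < m t by rewrite lt_def mt0 m0.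
  set s := (-1) ^+ g t i * d t i.
  have -> : d t i ^+ 2 = s ^+ 2.
    by rewrite /s; case: (g t i); rewrite ?expr0 ?mul1r // expr1 mulN1r sqrrN.
  rewrite -subr_ge0.
  have -> : m t / 6 + 3 / 2 * (s ^+ 2 / m t) - s = (m t - 3 * s) ^+ 2 / m t / 6.
    by field.
  by rewrite mulr_ge0 ?invr_ge0 ?ler0n // divr_ge0 ?sqr_ge0 ?ltW.
have lev t := level_one (a01 t).
rewrite (eq_bigr _ (fun i _ => succ i)) big_split sumr_const -mulr_sumr exchange_big /=.
have key : \sum_t \sum_i (-1) ^+ g t i * d t i <= #|I|%:R / 6 + 9 * ln #|T|%:R.
  apply: le_trans (_ : \sum_t (m t * (#|I|%:R / 6) + 9 * (m t * ln (m t)^-1)) <= _).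
    apply: ler_sum => t _.
    apply: le_trans (ler_sum _ (fun i _ => dle t i)) _.
    rewrite big_split sumr_const -mulr_sumr /= -[_ *+ #|_|]mulr_natr.
    by have := lev t; rewrite -/(m t) -/(d t) /=; lra.
  rewrite big_split -mulr_suml m1 mul1r -mulr_sumr lerD2l ler_wpM2l //.
  exact: entropy_le.
by rewrite -[2^-1 *+ #|_|]mulr_natr; lra.
Qed.

End OneWay.

(** * Two-party protocols for DISJOINTNESS *)

Section Disjointness.
Context {R : realType} {I : finType}.
Local Notation cube := {ffun I -> bool}.
Implicit Types (x u v S : cube) (i : I).

(** [S] says which side each element belongs to. Alice gets [restr S u] and Bob [restr (neg S) v],
    so their inputs are always disjoint. *)
Definition restr S u : cube := [ffun i => S i && u i].
Definition neg S : cube := [ffun i => ~~ S i].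

Lemma upd_restr_upd S u i c b :
  upd (restr (upd S i c) u) i b = upd (restr S u) i b.
Proof. by apply/ffunP => j; rewrite !ffunE; case: eqP. Qed.

Lemma neg_upd S i c : neg (upd S i c) = upd (neg S) i (~~ c).
Proof. by apply/ffunP => j; rewrite !ffunE; case: eqP. Qed.

Lemma negK S : neg (neg S) = S.
Proof. by apply/ffunP => j; rewrite !ffunE negbK. Qed.

Lemma avg_half i (c : bool) (F : cube -> R) : (forall S b, F (upd S i b) = F S) ->
  avg F = 2 * avg (fun S => (S i == c)%:R * F S).
Proof.
move=> FE.
have E b : avg (fun S => (upd S i b i == c)%:R * F (upd S i b)) = (b == c)%:R * avg F.
  by rewrite -avgZ; apply: eq_avg => S; rewrite FE ffunE eqxx.
by rewrite [in RHS](avg_upd i) !E; case: c {E} => /=; field.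
Qed.

(** If both [a1] and [b1] keep a fraction 7/8 of [a0] and [b0], then [a1 * b1] keeps 49/64, more
    than 3/4. If one drops further, say [a1 < 7 / 8 * a0], then the quotient exceeds [a0 / 120], so
    128 times it covers [a0]; and 96 is 3/4 of 128. *)
Lemma cut_and_paste (a0 a1 b0 b1 : R) :
  0 <= a0 -> 0 <= a1 -> 0 <= b0 -> 0 <= b1 ->
  3 / 4 * (a0 * b0) <= a1 * b1 + 96 * ((a0 - a1) ^+ 2 / (a0 + a1) * b0 +
                                      (b0 - b1) ^+ 2 / (b0 + b1) * a0).
Proof.
move=> a00 a10 b00 b10.
have t0 (x y z : R) : 0 <= x -> 0 <= y -> 0 <= z -> 0 <= (x - y) ^+ 2 / (x + y) * z.
  by move=> ? ? ?; rewrite mulr_ge0 ?divr_ge0 ?sqr_ge0 ?addr_ge0.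
have bad (x y z : R) : 0 <= x -> 0 <= y -> 0 <= z -> y < 7 / 8 * x ->
    x * z <= 128 * ((x - y) ^+ 2 / (x + y) * z).
  move=> x0 y0 z0 yx; rewrite mulrA ler_wpM2r // mulrA ler_pdivlMr; last by lra.
  by rewrite !expr2; nra.
have A0 := t0 _ _ _ a00 a10 b00; have B0 := t0 _ _ _ b00 b10 a00.
have ab : 0 <= a1 * b1 by rewrite mulr_ge0.
have [ha|ha] := ltrP a1 (7 / 8 * a0); first by have := bad _ _ _ a00 a10 b00 ha; lra.
have [hb|hb] := ltrP b1 (7 / 8 * b0); first by have := bad _ _ _ b00 b10 a00 hb; lra.
suff : 3 / 4 * (a0 * b0) <= a1 * b1 by lra.
apply: le_trans (_ : (7 / 8 * a0) * (7 / 8 * b0) <= _).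
  have := mulr_ge0 a00 b00; set w := a0 * b0 => w0.
  have -> : 7 / 8 * a0 * (7 / 8 * b0) = 49 / 64 * w by rewrite /w; field.
  lra.
by apply: ler_pM => //; lra.
Qed.

Section Protocol.
Context {T : finType}.
Implicit Types (a b : T -> cube -> R).

Definition cond a t S i c : R := avg (fun u => a t (upd (restr S u) i c)).

Lemma cond_upd a t S i c d : cond a t (upd S i d) i c = cond a t S i c.
Proof. by apply: eq_avg => u; rewrite upd_restr_upd. Qed.

(** The contribution of transcript [t] to the triangular discrimination between its distributions
    when [i] is held by nobody and when it is held by the player with factor [a]; the other player
    does not hold [i] in either case. *)
Definition bias a b t S i : R :=
  (cond a t S i false - cond a t S i true) ^+ 2 /
    (cond a t S i false + cond a t S i true) * cond b t (neg S) i false.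

Lemma bias_upd a b t S i d : bias a b t (upd S i d) i = bias a b t S i.
Proof. by rewrite /bias neg_upd !cond_upd. Qed.

(** For fixed [S], the level-one inequality for Alice's factor bounds the biases of one transcript
    by a multiple of its entropy term; summing over transcripts leaves [ln #|T|]. *)
Lemma sum_bias_le a b S :
  (forall t x, 0 <= a t x <= 1) -> (forall t x, 0 <= b t x <= 1) ->
  (forall x y, \sum_t a t x * b t y = 1) ->
  \sum_i (S i == true)%:R * \sum_t bias a b t S i <= 12 * ln #|T|%:R.
Proof.
move=> a01 b01 ab1.
pose f t u := a t (restr S u); pose g t v := b t (restr (neg S) v).
pose P t := avg (f t) * avg (g t).
have f0 t : 0 <= avg (f t) by apply: avg_ge0 => u; case/andP: (a01 t (restr S u)).
have g0 t : 0 <= avg (g t) by apply: avg_ge0 => u; case/andP: (b01 t (restr (neg S) u)).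
have g1 t : avg (g t) <= 1.
  rewrite -(avg_cst (1 : R) (I := I)); apply: le_avg => u.
  by case/andP: (b01 t (restr (neg S) u)).
have P0 t : 0 <= P t by rewrite mulr_ge0.
have P1 : \sum_t P t = 1.
  transitivity (avg (fun u => avg (fun v => \sum_t f t u * g t v))).
    rewrite (eq_avg (g := fun u => \sum_t f t u * avg (g t))).
      by rewrite avg_sum; apply: eq_bigr => t _; rewrite avgZr.
    by move=> u; rewrite avg_sum; apply: eq_bigr => t _; rewrite avgZ.
  rewrite (eq_avg (g := fun=> 1)) ?avg_cst // => u.
  by rewrite (eq_avg (g := fun=> 1)) ?avg_cst // => v; apply: ab1.
pose d t i := avg (fun u => f t u * (-1) ^+ u i).
(* If [i] is on Alice's side, forcing her bit at [i] amounts to setting [u i], and Bob's bit at [i]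
   is already false. So [avg (f t)] and [d t i] are the half sum and half difference of the two
   conditional means. *)
have biasE t i : S i -> bias a b t S i = 2 * (d t i ^+ 2 / avg (f t)) * avg (g t).
  move=> Si.
  have fE c u : f t (upd u i c) = a t (upd (restr S u) i c).
    rewrite /f; congr (a t _); apply/ffunP => j; rewrite !ffunE.
    by case: eqP => // ->; rewrite Si.
  have gE v : b t (upd (restr (neg S) v) i false) = g t v.
    rewrite /g; congr (b t _); apply/ffunP => j; rewrite !ffunE.
    by case: eqP => // ->; rewrite Si.
  have -> : avg (f t) = (cond a t S i false + cond a t S i true) / 2.
    by rewrite (avg_upd i); congr ((_ + _) / 2); apply: eq_avg => u; rewrite fE.
  have -> : d t i = (cond a t S i false - cond a t S i true) / 2.
    rewrite /d (avg_upd i); congr (_ / 2); congr (_ + _).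
      by apply: eq_avg => u; rewrite fE ffunE eqxx expr0 mulr1.
    rewrite -[RHS]mulN1r /cond -avgZ; apply: eq_avg => u.
    by rewrite fE ffunE eqxx expr1 mulrC.
  rewrite /bias (_ : cond b t (neg S) i false = avg (g t)); last exact: eq_avg.
  have [->|nz] := eqVneq (cond a t S i false + cond a t S i true) 0.
    by rewrite !mul0r !invr0 !mulr0 !mul0r.
  by field.
apply: le_trans (_ : \sum_t 12 * (P t * ln (P t)^-1) <= _); last first.
  by rewrite -mulr_sumr ler_wpM2l //; apply: entropy_le.
under eq_bigr do rewrite mulr_sumr.
rewrite exchange_big; apply: ler_sum => t _ /=.
have lev := level_one (fun u => a01 t (restr S u)).
apply: le_trans (_ : \sum_i 2 * (d t i ^+ 2 / avg (f t)) * avg (g t) <= _).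
  apply: ler_sum => i _; case Si: (S i); rewrite /= ?mul1r ?mul0r; first by rewrite biasE.
  by rewrite mulr_ge0 ?g0 // mulr_ge0 // divr_ge0 ?sqr_ge0 ?f0.
rewrite -mulr_suml -mulr_sumr.
apply: le_trans (_ : 2 * (6 * (avg (f t) * ln (avg (f t))^-1)) * avg (g t) <= _).
  by rewrite ler_wpM2r ?g0 // ler_wpM2l.
have [Pt|Pt] := eqVneq (P t) 0.
  rewrite Pt mul0r mulr0; move/eqP: Pt; rewrite mulf_eq0 => /orP[]/eqP ->.
    by rewrite mul0r !mulr0 mul0r.
  by rewrite mulr0.
have [fp gp] : 0 < avg (f t) /\ 0 < avg (g t).
  by move: Pt; rewrite mulf_eq0 negb_or => /andP[? ?]; rewrite !lt_def f0 g0 !andbT.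
have -> : 2 * (6 * (avg (f t) * ln (avg (f t))^-1)) * avg (g t) =
          12 * (P t * ln (avg (f t))^-1) by rewrite /P; ring.
(* [P t <= avg (f t)] because [avg (g t) <= 1], so passing to [P t] only increases the logarithm. *)
apply: ler_wpM2l => //; apply: ler_wpM2l; first exact: P0.
have Pp : 0 < P t by rewrite mulr_gt0.
rewrite ler_ln ?posrE ?invr_gt0 //.
rewrite lef_pV2 ?posrE // /P -[leRHS]mulr1.
by rewrite ler_wpM2l.
Qed.

(** The bias at [i] does not depend on [S i], so conditioning on [i] being on Alice's side is free;
    the event has probability 1/2, which doubles the constant. *)
Lemma avg_bias_le a b :
  (forall t x, 0 <= a t x <= 1) -> (forall t x, 0 <= b t x <= 1) ->
  (forall x y, \sum_t a t x * b t y = 1) ->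
  \sum_i avg (fun S => \sum_t bias a b t S i) <= 24 * ln #|T|%:R.
Proof.
move=> a01 b01 ab1.
rewrite (eq_bigr (fun i => 2 * avg (fun S => (S i == true)%:R * \sum_t bias a b t S i))).
  rewrite -mulr_sumr -avg_sum.
  apply: le_trans (_ : 2 * avg (fun S : cube => 12 * ln #|T|%:R) <= _).
    by rewrite ler_wpM2l //; apply: le_avg => S; apply: sum_bias_le.
  by rewrite avg_cst; lra.
move=> i _; apply: avg_half => S c.
by apply: eq_bigr => t _; rewrite bias_upd.
Qed.

(* Average of h over inputs that are disjoint off i (S says who may hold each
   element) and whose bits at i are both c. *)
Definition fill (h : cube -> cube -> R) i c : R :=
  avg (fun S => avg (fun u => avg (fun v =>
    h (upd (restr S u) i c) (upd (restr (neg S) v) i c)))).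

(** Given [S], the bits [u] and [v] are independent, so the average of a product of an Alice factor
    and a Bob factor is a product of averages. *)
Lemma fill_protocol a b (g : T -> R) i c :
  fill (fun x y => \sum_t a t x * b t y * g t) i c =
  avg (fun S => \sum_t cond a t S i c * cond b t (neg S) i c * g t).
Proof.
apply: eq_avg => S.
rewrite (eq_avg (g := fun u => \sum_t a t (upd (restr S u) i c) *
   (cond b t (neg S) i c * g t))).
  by rewrite avg_sum; apply: eq_bigr => t _; rewrite avgZr mulrA.
move=> u; rewrite avg_sum; apply: eq_bigr => t _.
by rewrite -avgZr -avgZ; apply: eq_avg => v; rewrite mulrA.
Qed.

(** Cut-and-paste is applied for each [S], [i] and [t], and weighted by [g t <= 1]. The error is 96
    times the biases of both players, each at most [24 * ln #|T|] in total. *)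
Lemma disjointness_protocol a b (g : T -> R)
    (h := fun x y => \sum_t a t x * b t y * g t) :
  (forall t x, 0 <= a t x <= 1) -> (forall t x, 0 <= b t x <= 1) ->
  (forall x y, \sum_t a t x * b t y = 1) -> (forall t, 0 <= g t <= 1) ->
  3 / 4 * \sum_i fill h i false <= \sum_i fill h i true + 96 * 48 * ln #|T|%:R.
Proof.
move=> a01 b01 ab1 g01.
have c0 e t S i c : (forall t x, 0 <= e t x <= 1) -> 0 <= cond e t S i c.
  by move=> e01; apply: avg_ge0 => u; case/andP: (e01 t (upd (restr S u) i c)).
have ba1 x y : \sum_t b t x * a t y = 1.
  by rewrite -(ab1 y x); apply: eq_bigr => t _; rewrite mulrC.
have A := avg_bias_le a01 b01 ab1; have B := avg_bias_le b01 a01 ba1.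
(* Bob's side is [neg S], which is as uniform as [S]. *)
have negE i : avg (fun S => \sum_t bias b a t (neg S) i) =
              avg (fun S => \sum_t bias b a t S i).
  by rewrite /avg [in RHS](reindex_inj (inv_inj negK)).
rewrite -(eq_bigr _ (fun i _ => negE i)) in B.
apply: le_trans (_ : \sum_i (fill h i true + 96 *
  (avg (fun S => \sum_t bias a b t S i) + avg (fun S => \sum_t bias b a t (neg S) i))) <= _);
  last by rewrite big_split -mulr_sumr big_split /=; lra.
rewrite mulr_sumr; apply: ler_sum => i _.
rewrite !fill_protocol -avgD -!avgZ -avgD; apply: le_avg => S.
rewrite -big_split !mulr_sumr -big_split /=; apply: ler_sum => t _.
rewrite /bias negK.
have A0 := c0 a t S i false a01; have A1 := c0 a t S i true a01.
have B0 := c0 b t (neg S) i false b01; have B1 := c0 b t (neg S) i true b01.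
have /andP[gt0 gt1] := g01 t; have := cut_and_paste A0 A1 B0 B1.
set G := _ + _ / _ * _ => CP.
have G0 : 0 <= G by rewrite /G addr_ge0 // mulr_ge0 // divr_ge0 ?sqr_ge0 ?addr_ge0.
have := ler_wpM2r gt0 CP; have : G * g t <= G by rewrite -[leRHS]mulr1 ler_wpM2l.
clearbody G; lra.
Qed.

End Protocol.
End Disjointness.

(** * Streaming algorithms as protocols *)

Lemma ln2_le1 (R : realType) : ln (2 : R) <= 1.
Proof. by have -> : (2 : R) = 1 + 1 by []; apply: le_ln1Dx; lra. Qed.

Lemma ln_expn2_le (R : realType) (k : nat) : ln ((2 ^ k)%N%:R : R) <= k%:R.
Proof.
rewrite natrX lnXn // -[_ *+ k]mulr_natl -[leRHS]mulr1.
by rewrite ler_wpM2l // ln2_le1.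
Qed.

(** A transcript lists the states handed over, two per pass. [a] checks that Alice's states follow
    from [x] and [b] that Bob's follow from [y]; exactly one transcript passes both checks, that of
    the actual run. *)
Lemma transcripts (R : realType) (X Y : Type) (Q : finType) (fA : nat -> X -> Q -> Q)
    (fB : nat -> Y -> Q -> Q) (q0 : Q) (p : nat) :
  exists (T : finType) (a : T -> X -> bool) (b : T -> Y -> bool) (out : T -> Q),
    #|T| = ((#|Q| ^ 2) ^ p)%N /\
    forall x y (g : Q -> R),
      \sum_t (a t x)%:R * (b t y)%:R * g (out t) =
      g (foldl (fun (r : Q) i => fB i y (fA i x r)) q0 (iota 0 p)).
Proof.
elim: p => [|p [T [a [b [out [cT IH]]]]]].
  exists unit, (fun _ _ => true), (fun _ _ => true), (fun=> q0).
  split=> [|x y g]; first by rewrite card_unit.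
  by rewrite (bigD1 tt) //= [X in _ + X]big1 => [|[] //]; rewrite !mul1r addr0.
exists (T * (Q * Q))%type,
  (fun t x => a t.1 x && (t.2.1 == fA p x (out t.1))),
  (fun t y => b t.1 y && (t.2.2 == fB p y t.2.1)), (fun t => t.2.2).
split=> [|x y g]; first by rewrite !card_prod cT [RHS]expnS mulnC mulnn.
rewrite -[p.+1]addn1 iotaD foldl_cat /= add0n.
rewrite -(IH x y (fun r : Q => g (fB p y (fA p x r)))).
rewrite -(pair_bigA _ (fun t qq => (a t x && (qq.1 == fA p x (out t)))%:R *
   (b t y && (qq.2 == fB p y qq.1))%:R * g qq.2)) /=; apply: eq_bigr => t _.
rewrite -(pair_bigA _ (fun (q : Q) q' => (a t x && (q == fA p x (out t)))%:R *
   (b t y && (q' == fB p y q))%:R * g q')) /=.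
rewrite (bigD1 (fA p x (out t))) //= [X in _ + X]big1 ?addr0; last first.
  by move=> r /negPf qN; rewrite big1 // => q' _; rewrite qN andbF !mul0r.
rewrite (bigD1 (fB p y (fA p x (out t)))) //= [X in _ + X]big1 ?addr0; last first.
  by move=> r /negPf qN; rewrite qN andbF mulr0 mul0r.
by rewrite !eqxx !andbT.
Qed.

Section Streaming.
Context {R : realType} {tok : Type} {m : nat}.
Variable A : algorithm R tok m.
Implicit Types (w : seed A) (q : m.-tuple bool).

Lemma prob_outputE p (t : seq tok) ans :
  prob_output A p t ans = \sum_(w : seed A) seed_prob w * (run p w t == ans)%:R.
Proof.
by rewrite /prob_output big_mkcond; apply: eq_bigr => w _; rewrite mulr_natr mulrb.
Qed.

Lemma mean_cst (a : R) : \sum_(w : seed A) seed_prob w * a = a.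
Proof. by rewrite -mulr_suml seed_prob_sum1 mul1r. Qed.

Lemma prob_output_compl p (t : seq tok) :
  prob_output A p t true + prob_output A p t false = 1.
Proof.
rewrite !prob_outputE -big_split -[RHS](seed_prob_sum1 A); apply: eq_bigr => w _ /=.
by case: run; rewrite /= !(mulr1n, mulr0n, mulr1, mulr0, addr0, add0r).
Qed.

(** The offset [j] lets a suffix of the stream run with the clock positions it has in the whole
    stream. *)
Definition run_from j w i q (t : seq tok) :=
  foldl (fun q jx => step w i jx.1 q jx.2) q (zip (iota j (size t)) t).

Lemma run_pass_cat w i q t1 t2 :
  run_pass w i q (t1 ++ t2) = run_from (size t1) w i (run_from 0 w i q t1) t2.
Proof.
by rewrite /run_pass size_cat iotaD zip_cat ?size_iota // foldl_cat.
Qed.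

Section Index.
Context {I : finType}.
Variables (s : nat) (tA : {ffun I -> bool} -> seq tok) (tB : I -> seq tok).

(** The memory after Alice's part is the message; the common length [s] tells Bob the clock. The
    constant is [54 = (9 / 2) / (2 / 3 - 7 / 12)]. *)
Lemma index_streaming :
  (forall x, size (tA x) = s) ->
  (forall x i, 2 / 3 <= prob_output A 1 (tA x ++ tB i) (~~ x i)) ->
  #|I|%:R <= 54 * m%:R :> R.
Proof.
move=> sA H.
pose st w x := run_from 0 w 0 (init w) (tA x).
pose g w q i := ~~ output w (run_from s w 0 q (tB i)).
pose a w q x : R := (st w x == q)%:R.
have runE w x i : (run 1 w (tA x ++ tB i) == ~~ x i)%:R =
    \sum_q a w q x * (g w q i == x i)%:R.
  rewrite (bigD1 (st w x)) //= big1 => [|q /negPf]; last first.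
    by rewrite eq_sym /a => ->; rewrite mul0r.
  rewrite /a eqxx mul1r addr0 /run /= run_pass_cat sA /g -/(st w x).
  by case: output; case: (x i).
have a01 w q x : 0 <= a w q x <= 1 by rewrite /a ler0n lern1; case: eqP.
have a1 w x : \sum_q a w q x = 1.
  rewrite (bigD1 (st w x)) //= big1 ?addr0 /a ?eqxx // => q /negPf.
  by rewrite eq_sym => ->.
have up : \sum_(w : seed A) seed_prob w *
      \sum_i avg (fun x => \sum_q a w q x * (g w q i == x i)%:R)
    <= 7 / 12 * #|I|%:R + 9 / 2 * m%:R.
  rewrite -[leRHS]mean_cst; apply: ler_sum => w _.
  apply: ler_wpM2l; first exact: seed_prob_ge0.
  apply: le_trans (one_way_success (g w) (a01 w) (a1 w)) _.
  by rewrite card_tuple card_bool lerD2l ler_wpM2l // ln_expn2_le.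
have dn : #|I|%:R * (2 / 3) <=
    \sum_(w : seed A) seed_prob w *
      \sum_i avg (fun x => \sum_q a w q x * (g w q i == x i)%:R).
  under [leRHS]eq_bigr do rewrite mulr_sumr.
  rewrite exchange_big /= mulr_natl -sumr_const; apply: ler_sum => i _.
  under [leRHS]eq_bigr do rewrite -avgZ.
  rewrite -avg_sum -(avg_cst (2 / 3) (I := I)); apply: le_avg => x.
  apply: le_trans (H x i) _; rewrite prob_outputE le_eqVlt; apply/orP; left; apply/eqP.
  by apply: eq_bigr => w _; rewrite runE.
by lra.
Qed.

End Index.

Section Disj.
Context {I : finType}.
Local Notation cube := {ffun I -> bool}.

Lemma avg_lin (J : finType) (c : J -> R) (F : J -> cube -> R) :
  avg (fun x => \sum_j c j * F j x) = \sum_j c j * avg (F j).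
Proof. by rewrite avg_sum; apply: eq_bigr => j _; rewrite avgZ. Qed.

Lemma fill_sum (J : finType) (c : J -> R) (h : J -> cube -> cube -> R) i d :
  fill (fun x y => \sum_j c j * h j x y) i d = \sum_j c j * fill (h j) i d.
Proof.
pose H j S u v := h j (upd (restr S u) i d) (upd (restr (neg S) v) i d).
rewrite /fill -(avg_lin c (fun j S => avg (fun u => avg (H j S u)))).
apply: eq_avg => S; rewrite -(avg_lin c (fun j u => avg (H j S u))).
by apply: eq_avg => u; rewrite -(avg_lin c (fun j v => H j S u v)).
Qed.

Lemma le_fill (h : cube -> cube -> R) (e : R) i c :
  (forall S u v, h (upd (restr S u) i c) (upd (restr (neg S) v) i c) <= e) ->
  fill h i c <= e.
Proof.
move=> he; rewrite -(avg_cst e (I := I)); apply: le_avg => S.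
rewrite -(avg_cst e (I := I)); apply: le_avg => u.
rewrite -(avg_cst e (I := I)); exact: le_avg.
Qed.

Lemma ge_fill (h : cube -> cube -> R) (e : R) i c :
  (forall S u v, e <= h (upd (restr S u) i c) (upd (restr (neg S) v) i c)) ->
  e <= fill h i c.
Proof.
move=> he; rewrite -(avg_cst e (I := I)); apply: le_avg => S.
rewrite -(avg_cst e (I := I)); apply: le_avg => u.
rewrite -(avg_cst e (I := I)); exact: le_avg.
Qed.

Variables (p s : nat) (tA tB : cube -> seq tok).

(** Each seed gives a deterministic protocol, and the bound is averaged over seeds. Acceptance is at
    least 2/3 with bit [i] false and at most 1/3 with it true on both sides;
    [3 / 4 * (2 / 3) - 1 / 3 = 1 / 6] accounts for the constant. *)
Lemma disjointness_streaming :
  (forall x, size (tA x) = s) ->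
  (forall x y : cube, 2 / 3 <= prob_output A p (tA x ++ tB y)
                                 [forall i, ~~ (x i && y i)]) ->
  #|I|%:R <= 12 * 96 * 48 * (p * m)%N%:R :> R.
Proof.
move=> sA H.
pose h w x y : R := (run p w (tA x ++ tB y) == true)%:R.
have per_seed w : 3 / 4 * \sum_i fill (h w) i false <=
    \sum_i fill (h w) i true + 96 * 48 * (2 * (p * m)%N%:R).
  have [T [a [b [out [cT E]]]]] := transcripts R (fun i x q => run_from 0 w i q (tA x))
    (fun i y q => run_from s w i q (tB y)) (init w) p.
  pose aR t x : R := (a t x)%:R; pose bR t x : R := (b t x)%:R.
  have hE : h w = fun x y => \sum_t aR t x * bR t y * (output w (out t) == true)%:R.
    apply/funext => x; apply/funext => y; rewrite (E x y (fun q => (output w q == true)%:R)).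
    congr ((output w _ == true)%:R); rewrite -[LHS]/(foldl _ _ _).
    elim: (iota 0 p) (init w) => //= i r IHr q.
    by rewrite IHr run_pass_cat sA.
  rewrite hE; apply: le_trans (@disjointness_protocol _ _ _ aR bR _ _ _ _ _) _.
  - by move=> t x; rewrite /aR ler0n lern1; case: (a t x).
  - by move=> t x; rewrite /bR ler0n lern1; case: (b t x).
  - by move=> x y; rewrite -[RHS](E x y (fun=> 1)); apply: eq_bigr => t _; rewrite mulr1.
  - by move=> t; rewrite ler0n lern1; case: eqP.
  rewrite lerD2l; apply: ler_wpM2l; first by rewrite mulr_ge0.
  (* There are [2 ^ (2 * p * m)] transcripts. *)
  rewrite cT card_tuple card_bool -expnM -expnM.
  apply: le_trans (ln_expn2_le _ _) _.
  by rewrite -natrM ler_nat; nia.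
pose Pr x y := \sum_(w : seed A) seed_prob w * h w x y.
have PrE x y : Pr x y = prob_output A p (tA x ++ tB y) true by rewrite prob_outputE.
have total : 3 / 4 * \sum_i fill Pr i false <=
    \sum_i fill Pr i true + 96 * 48 * (2 * (p * m)%N%:R).
  have sw c : \sum_i fill Pr i c = \sum_(w : seed A) seed_prob w * \sum_i fill (h w) i c.
    under [RHS]eq_bigr do rewrite mulr_sumr.
    by rewrite exchange_big; apply: eq_bigr => i _; rewrite fill_sum.
  rewrite !sw -[X in _ <= _ + X]mean_cst -big_split mulr_sumr.
  apply: ler_sum => w _ /=; rewrite mulrCA -mulrDr.
  by apply: ler_wpM2l; [exact: seed_prob_ge0 | exact: per_seed].
have low : #|I|%:R * (2 / 3) <= \sum_i fill Pr i false.
  rewrite mulr_natl -sumr_const; apply: ler_sum => i _; apply: ge_fill => S u v.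
  rewrite PrE; set x := upd _ _ _; set y := upd _ _ _.
  have := H x y; suff -> : [forall j, ~~ (x j && y j)] = true by [].
  apply/forallP => j; rewrite /x /y !ffunE; case: eqP => // _.
  by case: (S j); rewrite /= ?andbF.
have high : \sum_i fill Pr i true <= #|I|%:R * (1 / 3).
  rewrite mulr_natl -sumr_const; apply: ler_sum => i _; apply: le_fill => S u v.
  rewrite PrE; set x := upd _ _ _; set y := upd _ _ _.
  have := prob_output_compl p (tA x ++ tB y).
  have := H x y; suff -> : [forall j, ~~ (x j && y j)] = false by lra.
  by apply/forallP => /(_ i); rewrite /x /y !ffunE eqxx.
by lra.
Qed.

End Disj.
End Streaming.

(** * Graphs and their vertex-arrival streams *)

(** With budget 0 only the empty set can be deleted, so all reductions may target triangle
    detection. *)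
Lemma triangle_deletion0 (n : nat) (G : sgraph 'I_n) :
  triangle_deletion G 0 = triangle_free G.
Proof.
have delE : triangle_free (delete G finset.set0) = triangle_free G.
  congr (~~ _); apply/idP/idP.
    move=> /existsP[x /existsP[y /existsP[z xyz]]].
    apply/existsP; exists (val x); apply/existsP; exists (val y).
    by apply/existsP; exists (val z).
  move=> /existsP[x /existsP[y /existsP[z xyz]]].
  have in0 (v : 'I_n) : v \in ~: (finset.set0 : {set 'I_n}) by rewrite !inE.
  by apply/existsP; exists (Sub x (in0 x)); apply/existsP; exists (Sub y (in0 y));
     apply/existsP; exists (Sub z (in0 z)).
apply/existsP/idP => [[X]|tf]; last by exists finset.set0; rewrite cards0 delE.
by rewrite leqn0 cards_eq0 => /andP[/eqP->]; rewrite delE.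
Qed.

(* A graph on 'I_n is given by the edges e v u from each vertex v down to the
   smaller vertices u; the vertices arrive in increasing order. *)
Section DownGraph.
Variables (n : nat) (e : nat -> nat -> bool).

Definition down (v u : nat) : bool := (u < v)%N && e v u.

Definition down_adj : rel 'I_n := fun u v => down v u || down u v.

Lemma down_adj_sym : symmetric down_adj.
Proof. by move=> u v; rewrite /down_adj orbC. Qed.

Lemma down_adj_irrefl : irreflexive down_adj.
Proof. by move=> u; rewrite /down_adj /down ltnn. Qed.

Definition down_graph := SGraph down_adj_sym down_adj_irrefl.

Definition down_degree (v : nat) : nat := #|[set u : 'I_n | down v u]|.

Lemma triangle_freePn :
  reflect (exists a b c, [/\ a < b, b < c, c < n & [&& e b a, e c a & e c b]]%N)
          (~~ triangle_free down_graph).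
Proof.
rewrite /triangle_free negbK; apply: (iffP existsP) => [[x]|[a [b [c [ab bc cn T]]]]].
  move=> /existsP[y /existsP[z]]; rewrite /= /down_adj /down => H.
  have [xy|yx|xy] := ltngtP x y; have [yz|zy|yz] := ltngtP y z;
  have [xz|zx|xz] := ltngtP x z; move: H; rewrite ?xy ?yz ?xz ?ltnn ?andbF //=;
  try lia.
  - by exists x, y, z; split=> //; lia.
  - by exists x, z, y; split=> //; lia.
  - by exists z, x, y; split=> //; lia.
  - by exists y, x, z; split=> //; lia.
  - by exists y, z, x; split=> //; lia.
  - by exists z, y, x; split=> //; lia.
have bn : (b < n)%N by lia.
have an : (a < n)%N by lia.
exists (Ordinal an); apply/existsP; exists (Ordinal bn); apply/existsP.
exists (Ordinal cn); rewrite /= /down_adj /down /=.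
have ac : (a < c)%N by lia.
by rewrite ab bc ac; case/and3P: T => -> -> ->.
Qed.

Definition block (v : 'I_n) : seq (token n) :=
  Arrive v :: [seq Edge v u | u : 'I_n <- enum 'I_n & down v u].

Definition blocks (s : seq 'I_n) : seq (token n) := flatten [seq block v | v <- s].

Lemma blocks_cat s t : blocks (s ++ t) = blocks s ++ blocks t.
Proof. by rewrite /blocks map_cat flatten_cat. Qed.

Lemma size_block v : size (block v) = (down_degree v).+1.
Proof.
rewrite /= size_map /down_degree cardE; congr (size _).+1.
by rewrite -filter_predI; apply: eq_filter => u; rewrite /= !inE andbT.
Qed.

Lemma mem_take_enum_ord k (u : 'I_n) : (u \in take k (enum 'I_n)) = (u < k)%N.
Proof.
rewrite -(mem_map val_inj) map_take val_enum_ord take_iota mem_iota /= add0n.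
by have := ltn_ord u; lia.
Qed.

Lemma VA_blocks : VA down_graph (blocks (enum 'I_n)).
Proof.
exists (enum 'I_n); first by move=> v; rewrite mem_enum.
have szE : size (enum 'I_n) = n by rewrite size_enum_ord.
suff H k : (k <= n)%N ->
    va_prefix down_graph (take k (enum 'I_n)) (blocks (take k (enum 'I_n))).
  by have := H n (leqnn n); rewrite take_oversize ?szE.
elim: k => [|k IH] kn; first by rewrite take0; constructor.
pose v := Ordinal kn.
have -> : take k.+1 (enum 'I_n) = rcons (take k (enum 'I_n)) v.
  by rewrite (take_nth v) ?szE // (nth_ord_enum v v).
rewrite -cats1 blocks_cat cats1 /blocks /= cats0; apply: va_expose.
- by apply: IH; lia.
- by rewrite mem_take_enum_ord ltnn.
- by rewrite filter_uniq ?enum_uniq.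
- move=> u; rewrite mem_filter mem_enum andbT mem_take_enum_ord /= /down_adj /down /=.
  by case: ltngtP.
Qed.

End DownGraph.

Lemma down_degree0 n (e : nat -> nat -> bool) v :
  (forall u, (u < v)%N -> e v u = false) -> down_degree n e v = 0%N.
Proof.
move=> ev; apply/eqP; rewrite cards_eq0; apply/eqP/setP => u; rewrite !inE /down.
by case: ltnP => // uv; rewrite ev.
Qed.

Lemma down_degree1 n (e : nat -> nat -> bool) v r : (r < v)%N -> (v <= n)%N ->
  (forall u, (u < v)%N -> e v u = (u == r)) -> down_degree n e v = 1%N.
Proof.
move=> rv vn ev; have rn : (r < n)%N by lia.
rewrite -(cards1 (Ordinal rn)); apply: eq_card => u; rewrite !inE /down -val_eqE /=.
case: ltnP => uv; first by rewrite ev.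
by apply/esym/negP => /eqP ur; lia.
Qed.

Section Degree.
Variables (n : nat) (e : nat -> nat -> bool).

Lemma sum_degree_le :
  (\sum_(v : 'I_n) degree (down_graph n e) v <= 2 * \sum_(v < n) down_degree n e v)%N.
Proof.
have cardE' (P : pred 'I_n) : #|[set u | P u]| = (\sum_(u < n) P u)%N.
  by rewrite cardsE -sum1_card big_mkcond.
apply: (@leq_trans (\sum_(v < n) \sum_(u < n) (down e v u + down e u v))).
  apply: leq_sum => v _; rewrite /degree cardE'; apply: leq_sum => u _.
  by rewrite /= /down_adj; case: (down e v u); case: (down e u v).
rewrite (eq_bigr _ (fun v _ => big_split _ _ _ _ _)) big_split /= [X in (_ + X)%N]exchange_big.
rewrite addnn -mul2n leq_mul2l; apply: leq_sum => v _; by rewrite /down_degree cardE'.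
Qed.

(** All vertices but the last two send at most one edge down, and those two at most [n] each: at
    most [3 * n] edges, each counted twice in the degree sum. *)
Lemma avg_degree_le (R : realType) :
  (forall v, (v.+2 < n)%N -> (down_degree n e v <= 1)%N) ->
  avg_degree R (down_graph n e) <= 6.
Proof.
move=> e1; rewrite /avg_degree card_ord.
have [->|n0] := posnP n; first by rewrite invr0 mulr0.
rewrite ler_pdivrMr ?ltr0n // -natrM ler_nat.
apply: leq_trans sum_degree_le _; rewrite -[6%N]/(2 * 3)%N -mulnA leq_mul2l /=.
have dn v : (down_degree n e v <= n)%N by rewrite -[leqRHS]card_ord max_card.
clear n0; case: n e1 dn => [|[|k]] e1 dn; first by rewrite big_ord0.
  by rewrite big_ord_recr big_ord0 /=; have := dn 0%N; lia.
rewrite !big_ord_recr /=; have dk := dn k; have dk1 := dn k.+1.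
apply: (@leq_trans (k + k.+2 + k.+2)); last by lia.
rewrite !leq_add //.
rewrite -[leqRHS]card_ord -sum1_card; apply: leq_sum => i _; apply: e1.
by have := ltn_ord i; lia.
Qed.

End Degree.

Lemma vc_number_le n (G : sgraph 'I_n) (S : {set 'I_n}) :
  vertex_cover G S -> (vc_number G <= #|S|)%N.
Proof.
move=> cS; rewrite /vc_number; case: arg_minnP => [|X _]; last exact.
by apply/forallP => u; apply/forallP => v; rewrite inE implybT.
Qed.

Section Split.
Variables (n m : nat).
Implicit Types e f : nat -> nat -> bool.

(* Alice owns the vertices below m, Bob the others. *)
Definition split_edges e f v u : bool := if (v < m)%N then e v u else f v u.

Lemma blocks_split e f :
  blocks (split_edges e f) (enum 'I_n) =
  blocks e (take m (enum 'I_n)) ++ blocks f (drop m (enum 'I_n)).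
Proof.
rewrite -{1}(cat_take_drop m (enum 'I_n)) blocks_cat /blocks; congr (flatten _ ++ flatten _).
  apply/eq_in_map => v; rewrite mem_take_enum_ord => vm; congr (_ :: map _ _).
  by apply: eq_filter => u; rewrite /down /split_edges vm.
apply/eq_in_map => v vd; congr (_ :: map _ _).
have := enum_uniq 'I_n; rewrite -{1}(cat_take_drop m (enum 'I_n)) cat_uniq.
case/and3P => _ /hasPn /(_ _ vd) vt _.
have {vt} vm : (v < m)%N = false by move: vt; rewrite mem_take_enum_ord => /negPf.
by apply: eq_filter => u; rewrite /down /split_edges vm.
Qed.

(** This makes the length of Alice's part independent of her input, as the communication bounds
    require. *)
Lemma size_blocks_eq e f :
  (forall v, (v < n)%N -> (v < m)%N -> down_degree n e v = down_degree n f v) ->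
  size (blocks e (take m (enum 'I_n))) = size (blocks f (take m (enum 'I_n))).
Proof.
move=> ef; rewrite !size_flatten /shape -!map_comp; congr sumn.
apply/eq_in_map => v; rewrite mem_take_enum_ord => vm.
by rewrite /comp !size_block ef.
Qed.

Lemma disjointness_down_graph (R : realType) (I : finType) (b p : nat)
    (A : algorithm R (token n) b) (eA eB : {ffun I -> bool} -> nat -> nat -> bool) :
  (forall x x' v, (v < n)%N -> (v < m)%N ->
     down_degree n (eA x) v = down_degree n (eA x') v) ->
  (forall x y, 2 / 3 <= prob_output A p (blocks (split_edges (eA x) (eB y)) (enum 'I_n))
                          [forall i, ~~ (x i && y i)]) ->
  #|I|%:R <= 12 * 96 * 48 * (p * b)%N%:R :> R.
Proof.
move=> eAE H; pose x0 : {ffun I -> bool} := [ffun=> false].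
apply: (@disjointness_streaming _ _ _ A _ p (size (blocks (eA x0) (take m (enum 'I_n))))
  (fun x => blocks (eA x) (take m (enum 'I_n)))
  (fun y => blocks (eB y) (drop m (enum 'I_n)))).
- by move=> x; apply: size_blocks_eq => v vn vm; apply: eAE.
- by move=> x y; rewrite -blocks_split; apply: H.
Qed.

Lemma index_down_graph (R : realType) (I : finType) (b : nat)
    (A : algorithm R (token n) b) (eA : {ffun I -> bool} -> nat -> nat -> bool)
    (eB : I -> nat -> nat -> bool) :
  (forall x x' v, (v < n)%N -> (v < m)%N ->
     down_degree n (eA x) v = down_degree n (eA x') v) ->
  (forall x i, 2 / 3 <= prob_output A 1 (blocks (split_edges (eA x) (eB i)) (enum 'I_n))
                          (~~ x i)) ->
  #|I|%:R <= 54 * b%:R :> R.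
Proof.
move=> eAE H; pose x0 : {ffun I -> bool} := [ffun=> false].
apply: (@index_streaming _ _ _ A _ (size (blocks (eA x0) (take m (enum 'I_n))))
  (fun x => blocks (eA x) (take m (enum 'I_n)))
  (fun i => blocks (eB i) (drop m (enum 'I_n)))).
- by move=> x; apply: size_blocks_eq => v vn vm; apply: eAE.
- by move=> x i; rewrite -blocks_split; apply: H.
Qed.

End Split.

Lemma little_o_bound (R : realType) (space : nat -> nat -> nat) (f : nat -> nat -> R)
    (kappa : nat) (eps : R) :
  little_o space f -> 0 < eps ->
  exists M, forall n, (M <= n)%N -> (space n kappa)%:R <= eps * `|f n kappa|.
Proof.
move=> /(_ kappa) /eqoP so eps0; have [M _ HM] := so _ eps0.
by exists M => n Mn; have := HM n Mn; rewrite /= normr_nat.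
Qed.

(** * Gadgets *)

Section IndexGadget.
Variable m : nat.
Local Notation K := {ffun 'I_m -> bool}.
Local Notation D := #|K|.
Local Notation rank k := (nat_of_ord (enum_rank (k : K))).

Let rank_inj (k k' : K) : rank k = rank k' -> k = k'.
Proof. by move=> kk; apply/enum_rank_inj/val_inj. Qed.

Let rank_lt (k : K) : (rank k < D)%N.
Proof. exact: ltn_ord. Qed.

Definition index_row (x : {ffun K * 'I_m -> bool}) (k : K) : K := [ffun l => x (k, l)].

(** Vertices below [D] are values, those from [D] to [2 * D - 1] are keys, and [2 * D] is Bob's.
    Keys and values are both [m]-bit strings, and key [k] is joined to the value spelled by row [k]
    of [x]. *)
Definition index_alice (x : {ffun K * 'I_m -> bool}) (v u : nat) : bool :=
  [exists k : K, (v == D + rank k)%N && (u == rank (index_row x k))].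

Definition index_bob (i : K * 'I_m) (v u : nat) : bool :=
  (u == D + rank i.1)%N || [exists k : K, k i.2 && (u == rank k)].

Let n := (2 * D).+1.

Let edges x i := split_edges (2 * D) (index_alice x) (index_bob i).

Lemma down_degree_index_alice x v : (v < 2 * D)%N ->
  down_degree n (index_alice x) v = (D <= v)%N.
Proof.
move=> vD; have [Dv|Dv] := leqP D v; last first.
  apply: down_degree0 => u _; apply/existsP => -[k /andP[/eqP vE _]].
  by move: Dv; rewrite vE ltnNge leq_addr.
have rD : (v - D < D)%N by lia.
pose k := enum_val (Ordinal rD).
have vE : v = (D + rank k)%N by rewrite /k enum_valK /=; lia.
have rk := rank_lt (index_row x k).
apply: (@down_degree1 _ _ _ (rank (index_row x k))); rewrite /n; [lia | lia |].
move=> u _; apply/existsP/eqP => [[k' /andP[/eqP vE' /eqP ->]]|->].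
  by rewrite (_ : k' = k) //; apply: rank_inj; lia.
by exists k; rewrite -vE !eqxx.
Qed.

Lemma triangle_free_index x i : triangle_free (down_graph n (edges x i)) = ~~ x i.
Proof.
case: i => k l; apply: negb_inj; rewrite negbK; apply/triangle_freePn/idP.
  move=> [a [b [c [ab bc cn]]]]; rewrite /edges /split_edges.
  have -> : (b < 2 * D)%N by rewrite /n in cn; lia.
  (* If [c] were Alice's, it would have the two lower neighbours [a] and [b], but her vertices have
     at most one. *)
  case: ltnP => cD /and3P[/existsP[k1 /andP[/eqP b1 /eqP a1]]].
    move=> /existsP[k2 /andP[/eqP c2 /eqP a2]] /existsP[k3 /andP[/eqP c3 /eqP b3]].
    have k23 : k2 = k3 by apply: rank_inj; lia.
    by move: ab; rewrite a2 b3 k23 ltnn.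
  have aD := rank_lt (index_row x k1).
  move=> /orP[/eqP /= a2|/existsP[k2 /andP[k2l /eqP a2]]]; first by lia.
  move=> /orP[/eqP /= b2|/existsP[k3 /andP[_ /eqP b3]]]; last first.
    by have := rank_lt k3; lia.
  have k1k : k1 = k by apply: rank_inj; apply: (@addnI D); rewrite -b1 -b2.
  have k2k : k2 = index_row x k1 by apply: rank_inj; rewrite -a1 -a2.
  by move: k2l; rewrite k2k k1k ffunE.
move=> xkl; have aD := rank_lt (index_row x k).
have bD := rank_lt k.
exists (rank (index_row x k)), (D + rank k)%N, (2 * D)%N.
rewrite /edges /split_edges ltnn (_ : (D + rank k < 2 * D)%N); last by lia.
split; rewrite /n; try lia; apply/and3P; split.
- by apply/existsP; exists k; rewrite !eqxx.
- by apply/orP; right; apply/existsP; exists (index_row x k); rewrite eqxx ffunE xkl.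
- by apply/orP; left.
Qed.

Lemma avg_degree_index (R : realType) x i :
  avg_degree R (down_graph n (edges x i)) <= 6.
Proof.
apply: avg_degree_le => v vn; have vD : (v < 2 * D)%N by rewrite /n in vn; lia.
have -> : down_degree n (edges x i) v = down_degree n (index_alice x) v.
  by apply: eq_card => u; rewrite !inE /down /edges /split_edges vD.
by rewrite down_degree_index_alice // leq_b1.
Qed.

End IndexGadget.

Lemma hard_avg_degree (R : realType) :
  hard VA (restricted_to TD_solution_size (fun n G => avg_degree R G <= 6))
    (fun n _ => n%:R * ln (n%:R : R)) 1.
Proof.
move=> space so [A sol].
(* As [n * ln n <= 12 * D * m] and [D * m <= 54 * space], any constant below 1/648 gives a
   contradiction. *)
have [M HM] := little_o_bound 0 so (eps := 1 / 1000) ltac:(lra).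
pose m := M.+1; pose D := #|{ffun 'I_m -> bool}|; pose n := (2 * D).+1.
have DE : D = (2 ^ m)%N by rewrite /D card_ffun card_bool card_ord.
have MD : (M.+1 < D)%N by rewrite DE ltn_expl.
have low : (D * m)%N%:R <= 54 * (space n 0%N)%:R :> R.
  have -> : (D * m)%N = #|{: {ffun 'I_m -> bool} * 'I_m}| by rewrite card_prod card_ord.
  apply: (@index_down_graph n (2 * D) _ _ _ (A n 0%N 0%N) (@index_alice m) (@index_bob m)).
    by move=> x x' v _ vD; rewrite !down_degree_index_alice.
  move=> x i; rewrite -triangle_free_index -triangle_deletion0.
  by apply: sol; [split=> //; apply: avg_degree_index | apply: VA_blocks].
have up : (space n 0%N)%:R <= 1 / 1000 * `|n%:R * ln (n%:R : R)| by apply: HM; lia.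
have n1 : 1 <= n%:R :> R by rewrite ler1n.
have lnn0 : 0 <= ln (n%:R : R) by apply: ln_ge0.
have lnn : ln (n%:R : R) <= 3 * m%:R.
  apply: le_trans (_ : ln ((2 ^ m.+2)%N%:R : R) <= _).
    rewrite ler_ln ?posrE ?ltr0n ?expn_gt0 // ler_nat.
    by rewrite -[m.+2]/(2 + m)%N expnD -DE; lia.
  apply: le_trans (ln_expn2_le _ _) _; rewrite -natrM ler_nat /m; lia.
have n4 : n%:R <= 4 * D%:R :> R by rewrite -natrM ler_nat; lia.
have nn : n%:R * ln (n%:R : R) <= 4 * D%:R * (3 * m%:R) by apply: ler_pM => //; lra.
move: up; rewrite ger0_norm ?mulr_ge0 // => up; rewrite natrM in low.
have : 0 < D%:R * m%:R :> R by rewrite mulr_gt0 ?ltr0n //; lia.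
by move: nn; rewrite (_ : 4 * _ * _ = 12 * (D%:R * m%:R)); [lra | ring].
Qed.

(** * Gadgets for DISJOINTNESS: bounded degree, then bounded vertex cover *)

Section DisjointnessGadgets.
Variable N : nat.
Local Notation cube := {ffun 'I_N.+1 -> bool}.
Implicit Types x y : cube.

Let bit x j : bool := x (inord j).

Section Sparse.
Let n := (4 * N.+1)%N.

(** Element [i] gets the four vertices [i + j * N.+1], [j < 4]: a target, a decoy, one active vertex
    of Alice and one of Bob. Alice's goes to the target if she holds [i] and to the decoy otherwise;
    Bob's goes to the target and to Alice's vertex if he holds [i]. *)
Definition sparse_alice x v u : bool :=
  (2 * N.+1 <= v)%N &&
  (u == v - 2 * N.+1 + (if bit x (v - 2 * N.+1) then 0 else N.+1))%N.

Definition sparse_bob y v u : bool :=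
  bit y (v - 3 * N.+1) && ((u == v - 3 * N.+1) || (u == v - N.+1))%N.

Let edges x y := split_edges (3 * N.+1) (sparse_alice x) (sparse_bob y).

Lemma down_degree_sparse_alice x v : (v < 3 * N.+1)%N ->
  down_degree n (sparse_alice x) v = (2 * N.+1 <= v)%N.
Proof.
move=> vN; have [Nv|Nv] := leqP (2 * N.+1)%N v; last first.
  by apply: down_degree0 => u _; rewrite /sparse_alice leqNgt Nv.
apply: (@down_degree1 _ _ _
  (v - 2 * N.+1 + (if bit x (v - 2 * N.+1) then 0 else N.+1))); rewrite /n.
- by case: bit; lia.
- by lia.
- by move=> u _; rewrite /sparse_alice Nv.
Qed.

Lemma triangle_free_sparse x y :
  triangle_free (down_graph n (edges x y)) = [forall i, ~~ (x i && y i)].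
Proof.
apply: negb_inj; rewrite negb_forall; apply/triangle_freePn/existsP.
  move=> [a [b [c [ab bc cn]]]]; rewrite /edges /split_edges /n in cn *.
  case: (ltnP c) => cN.
    rewrite (_ : (b < 3 * N.+1)%N); last by lia.
    by move=> /and3P[_ /andP[_ /eqP aE] /andP[_ /eqP bE]]; move: ab; rewrite aE bE ltnn.
  case: (ltnP b) => bN /and3P[ba ca cb]; last first.
    by move: cb => /andP[_ /orP[]/eqP]; lia.
  (* As [a < b], only the target [a = c - 3 * N.+1] and Alice's vertex [b = c - N.+1] remain. *)
  move: ca cb => /andP[yc /orP[]/eqP aE] /andP[_ /orP[]/eqP bE]; try lia.
  move: ba => /andP[_]; have -> : (b - 2 * N.+1 = c - 3 * N.+1)%N by lia.
  case xc: (bit x _) => /eqP; last by lia.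
  by exists (inord (c - 3 * N.+1)%N); rewrite negbK; apply/andP.
move=> [i]; rewrite negbK => /andP[xi yi]; have iN := ltn_ord i.
exists i, (2 * N.+1 + i)%N, (3 * N.+1 + i)%N; rewrite /edges /split_edges.
have -> : (2 * N.+1 + i < 3 * N.+1)%N by lia.
have -> : (3 * N.+1 + i < 3 * N.+1)%N = false by lia.
rewrite /sparse_alice /sparse_bob !addKn /bit inord_val xi yi /n /= leq_addr addn0 !eqxx.
by split; [lia | lia | lia | apply/eqP; lia].
Qed.

(** Edges stay within the four vertices of one element, which is what bounds the maximum degree. *)
Lemma edges_sparse_mod x y (v u : nat) : (v < n)%N -> down (edges x y) v u ->
  (u = v %[mod N.+1])%N.
Proof.
have modE k i : (i < N.+1)%N -> ((k * N.+1 + i) %% N.+1 = i)%N.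
  by move=> iN; rewrite modnMDl modn_small.
rewrite /n => vn /andP[uv]; rewrite /edges /split_edges; case: ltnP => vN.
  move=> /andP[vN2 /eqP ->]; set i := (v - 2 * N.+1)%N.
  have iN : (i < N.+1)%N by rewrite /i; lia.
  have -> : v = (2 * N.+1 + i)%N by rewrite /i; lia.
  by rewrite modE //; case: bit; rewrite ?addn0 ?modnDr modn_small.
move=> /andP[_ uE]; set i := (v - 3 * N.+1)%N.
have iN : (i < N.+1)%N by rewrite /i; lia.
have -> : v = (3 * N.+1 + i)%N by rewrite /i; lia.
rewrite modE //; case/orP: uE => /eqP ->; first by rewrite modn_small.
rewrite (_ : (v - N.+1 = 2 * N.+1 + i)%N) ?modE //; rewrite /i; lia.
Qed.

Lemma max_degree_sparse x y : (max_degree (down_graph n (edges x y)) <= 4)%N.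
Proof.
apply/bigmax_leqP => v _.
pose f (u : 'I_n) : 'I_4 := inord (u %/ N.+1)%N.
have f_inj : {in [set u | down_graph n (edges x y) v u] &, injective f}.
  have mE u : u \in [set u | down_graph n (edges x y) v u] -> (u = v %[mod N.+1])%N.
    rewrite inE => /orP[h|h]; last exact: (edges_sparse_mod (ltn_ord v) h).
    by apply/esym/(edges_sparse_mod (ltn_ord u) h).
  move=> u w /mE uE /mE wE /(congr1 (@nat_of_ord _)).
  have div4 (t : 'I_n) : (t %/ N.+1 < 4)%N by rewrite ltn_divLR // -/n.
  rewrite !inordK // => uw; apply: val_inj => /=.
  by rewrite (divn_eq u N.+1) (divn_eq w N.+1) uw uE wE.
by rewrite /degree -(card_in_imset f_inj) -[leqRHS](card_ord 4) max_card.
Qed.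

End Sparse.

Section Cover.
Let n := N.+4.

(** All elements share the target 0 and the decoy 1; element [i] is the vertex [2 + i], and [N.+3]
    is Bob's only vertex. *)
Definition cover_alice x v u : bool :=
  (2 <= v)%N && (u == if bit x (v - 2) then 0 else 1)%N.

Definition cover_bob y (v u : nat) : bool := (u == 0)%N || (2 <= u)%N && bit y (u - 2).

Let edges x y := split_edges N.+3 (cover_alice x) (cover_bob y).

Lemma down_degree_cover_alice x v : (v < N.+3)%N ->
  down_degree n (cover_alice x) v = (2 <= v)%N.
Proof.
move=> vN; have [v2|v2] := leqP 2 v; last first.
  by apply: down_degree0 => u _; rewrite /cover_alice leqNgt v2.
apply: (@down_degree1 _ _ _ (if bit x (v - 2) then 0 else 1)); rewrite /n.
- by case: bit; lia.
- by lia.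
- by move=> u _; rewrite /cover_alice v2.
Qed.

Lemma triangle_free_cover x y :
  triangle_free (down_graph n (edges x y)) = [forall i, ~~ (x i && y i)].
Proof.
apply: negb_inj; rewrite negb_forall; apply/triangle_freePn/existsP.
  move=> [a [b [c [ab bc cn]]]]; rewrite /edges /split_edges /n in cn *.
  case: (ltnP c) => cN.
    rewrite (_ : (b < N.+3)%N); last by lia.
    by move=> /and3P[_ /andP[_ /eqP aE] /andP[_ /eqP bE]]; move: ab; rewrite aE bE ltnn.
  rewrite (_ : (b < N.+3)%N); last by lia.
  move=> /and3P[/andP[b2 /eqP aE] ca cb].
  case xb : (bit x (b - 2)) aE => aE; last by move: ca; rewrite aE.
  move: cb => /orP[/eqP|/andP[_ yb]]; first by lia.
  by exists (inord (b - 2)%N); rewrite negbK; apply/andP.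
move=> [i]; rewrite negbK => /andP[xi yi]; have iN := ltn_ord i.
exists 0%N, (2 + i)%N, N.+3; rewrite /edges /split_edges ltnn.
have -> : (2 + i < N.+3)%N by lia.
by rewrite /cover_alice /cover_bob !addKn /bit inord_val xi yi.
Qed.

Lemma avg_degree_cover (R : realType) x y :
  avg_degree R (down_graph n (edges x y)) <= 6.
Proof.
apply: avg_degree_le => v vn; have vN : (v < N.+3)%N by rewrite /n in vn; lia.
have -> : down_degree n (edges x y) v = down_degree n (cover_alice x) v.
  by apply: eq_card => u; rewrite !inE /down /edges /split_edges vN.
by rewrite down_degree_cover_alice // leq_b1.
Qed.

(** The target, the decoy and Bob's vertex meet every edge. *)
Lemma vc_number_cover x y : (vc_number (down_graph n (edges x y)) <= 3)%N.
Proof.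
pose S : {set 'I_n} := [set inord 0; inord 1; inord N.+3].
apply: (@leq_trans #|S|); last first.
  by rewrite /S; apply: leq_trans (leq_card_setU _ _) _; rewrite cards1 cards2; case: eqP.
have inS (u : 'I_n) : (u <= 1)%N || (N.+3 <= u)%N -> u \in S.
  move=> uS; have un : (u < N.+4)%N := ltn_ord u.
  have [|[|]] : u = 0%N :> nat \/ u = 1%N :> nat \/ u = N.+3 :> nat by lia.
  - move=> u0; have -> : u = inord 0 by apply: val_inj; rewrite /= inordK.
    by rewrite !inE eqxx.
  - move=> u1; have -> : u = inord 1 by apply: val_inj; rewrite /= inordK.
    by rewrite !inE eqxx orbT.
  - move=> u2; have -> : u = inord N.+3 by apply: val_inj; rewrite /= inordK.
    by rewrite !inE eqxx orbT.
apply: vc_number_le; apply/forallP => u; apply/forallP => v; apply/implyP.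
suff cov (a b : 'I_n) : down (edges x y) a b -> (a \in S) || (b \in S).
  by case/orP => /cov; rewrite // orbC.
move=> /andP[_]; rewrite /edges /split_edges; case: ltnP => aN.
  by move=> /andP[_ /eqP bE]; rewrite (inS b) ?orbT // bE; case: bit.
by rewrite (inS a) // aN orbT.
Qed.

End Cover.
End DisjointnessGadgets.

Section Hardness.
Variables (R : realType) (p : nat).
Hypothesis p_gt0 : (0 < p)%N.

(** Both gadgets have at most 4 vertices per element, and [4 * 12 * 96 * 48 = 221184] is below the
    [1000 * 1000] in the choice of epsilon. *)
Lemma space_contradiction (N n b : nat) :
  (0 < N)%N -> (n <= 4 * N)%N -> N%:R <= 12 * 96 * 48 * (p * b)%N%:R :> R ->
  b%:R <= 1 / (1000 * 1000) * `|n%:R / p%:R| :> R -> False.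
Proof.
move=> N0 nN low; have p0 : 0 < p%:R :> R by rewrite ltr0n.
rewrite ger0_norm ?divr_ge0 // mulrA ler_pdivlMr // => up.
have nN' : n%:R <= 4 * N%:R :> R by rewrite -natrM ler_nat.
have N0' : 0 < N%:R :> R by rewrite ltr0n.
by move: low up; rewrite natrM [p%:R * _]mulrC; lra.
Qed.

Lemma hard_max_degree :
  hard VA (restricted_to TD_solution_size (fun n G => (max_degree G <= 4)%N))
    (fun n _ => n%:R / p%:R : R) p.
Proof.
move=> space so [A sol].
have [M HM] := little_o_bound 0 so (eps := 1 / (1000 * 1000)) ltac:(lra).
apply: (@space_contradiction M.+1 (4 * M.+1) (space (4 * M.+1)%N 0%N)) => //; last first.
  by apply: HM; lia.
rewrite -[M.+1 in X in X <= _]card_ord.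
apply: (@disjointness_down_graph _ (3 * M.+1) _ _ _ _ (A (4 * M.+1)%N 0%N 0%N)
  (@sparse_alice M) (@sparse_bob M)).
  by move=> x x' v _ vN; rewrite !down_degree_sparse_alice.
move=> x y; rewrite -triangle_free_sparse -triangle_deletion0.
by apply: sol; [split=> //; apply: max_degree_sparse | apply: VA_blocks].
Qed.

(** The parameter is fixed at 3, the size of the cover in the gadget, while [k = 0]. *)
Lemma hard_vertex_cover :
  hard VA (restricted_to TD_vertex_cover (fun n G => avg_degree R G <= 6))
    (fun n _ => n%:R / p%:R : R) p.
Proof.
move=> space so [A sol].
have [M HM] := little_o_bound 3 so (eps := 1 / (1000 * 1000)) ltac:(lra).
apply: (@space_contradiction M.+1 M.+4 (space M.+4 3%N)) => //;
  [lia | | by apply: HM; lia].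
rewrite -[M.+1 in X in X <= _]card_ord.
apply: (@disjointness_down_graph _ M.+3 _ _ _ _ (A M.+4 0%N 3%N)
  (@cover_alice M) (@cover_bob M)).
  by move=> x x' v _ vN; rewrite !down_degree_cover_alice.
move=> x y; rewrite -triangle_free_cover -triangle_deletion0.
apply: sol; last exact: VA_blocks.
by split; [split=> //; apply: vc_number_cover | apply: avg_degree_cover].
Qed.

End Hardness.

Theorem theorem5p2 (R : realType) :
  (exists C : R,
     hard VA (restricted_to TD_solution_size (fun n G => avg_degree R G <= C))
       (fun n _ => n%:R * ln (n%:R : R)) 1)
  /\
  (exists C : nat, forall p : nat, (0 < p)%N ->
     hard VA (restricted_to TD_solution_size (fun n G => (max_degree G <= C)%N))
       (fun n _ => n%:R / p%:R : R) p)
  /\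
  (exists C : R, forall p : nat, (0 < p)%N ->
     hard VA (restricted_to TD_vertex_cover (fun n G => avg_degree R G <= C))
       (fun n _ => n%:R / p%:R : R) p).
Proof.
split; [exists 6; exact: hard_avg_degree | split].
  by exists 4%N => p p_gt0; apply: hard_max_degree.
by exists 6 => p p_gt0; apply: hard_vertex_cover.
Qed.
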